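(* Let $p\ge 1$ and let $\Gamma:\Omega\to\mathcal{K}_c(\mathbb{R}^p)$ be a compact convex random set on a probability space $(\Omega,\mathcal{A},\mathbb{P})$. Then for every $K\in\mathcal{K}_c(\mathbb{R}^p)$, $$D_{CT}(K;\Gamma)=\inf_{u\in\mathbb{S}^{p-1}}HD\big(s_K(u);s_\Gamma(u)\big),$$ where $HD(\cdot\,;s_\Gamma(u))$ is the halfspace depth on $\mathbb{R}$ with respect to the distribution of the real random variable $s_\Gamma(u)$.
   Context: $\mathcal{K}_c(\mathbb{R}^p)$ denotes the set of non-empty compact convex subsets of $\mathbb{R}^p$, and $\mathbb{S}^{p-1}=\{x\in\mathbb{R}^p:\|x\|=1\}$ the Euclidean unit sphere. The support function of $K\in\mathcal{K}_c(\mathbb{R}^p)$ is $s_K:\mathbb{S}^{p-1}\to\mathbb{R}$, $s_K(u)=\sup_{k\in K}\langle k,u\rangle$. A map $\Gamma:\Omega\to\mathcal{K}_c(\mathbb{R}^p)$ on a probability space $(\Omega,\mathcal{A},\mathbb{P})$ is a compact convex random set if $\{\omega\in\Omega:\Gamma(\omega)\cap K\ne\emptyset\}\in\mathcal{A}$ for all $K\in\mathcal{K}_c(\mathbb{R}^p)$; equivalently, it is Borel measurable with respect to the Hausdorff metric. Then $s_\Gamma(u)$, $\omega\mapsto s_{\Gamma(\omega)}(u)$, is a real random variable for each $u\in\mathbb{S}^{p-1}$. For $u\in\mathbb{S}^{p-1}$, $t\in\mathbb{R}$, define the halfspaces $S^-_{u,t}=\{K\in\mathcal{K}_c(\mathbb{R}^p):s_K(u)\le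 t\}$ and $S^+_{u,t}=\{K\in\mathcal{K}_c(\mathbb{R}^p):s_K(u)\ge t\}$. The Tukey depth of $K\in\mathcal{K}_c(\mathbb{R}^p)$ with respect to $\Gamma$ is $$D_{CT}(K;\Gamma)=\min\Big\{\inf_{u\in\mathbb{S}^{p-1},\,t\in\mathbb{R}:\ K\in S^-_{u,t}}\mathbb{P}(\Gamma\in S^-_{u,t}),\ \inf_{u\in\mathbb{S}^{p-1},\,t\in\mathbb{R}:\ K\in S^+_{u,t}}\mathbb{P}(\Gamma\in S^+_{u,t})\Big\}.$$ For a probability distribution $Q$ on $\mathbb{R}^n$ and $x\in\mathbb{R}^n$, the (multivariate) halfspace depth is $HD(x;Q)=\inf\{Q(H): H\text{ is a closed halfspace and }x\in H\}$; for a random variable $X$ with distribution $Q$ one writes $HD(x;X)=HD(x;Q)$. On $\mathbb{R}$ the closed halfspaces are the half-lines $(-\infty,a]$ and $[a,\infty)$, $a\in\mathbb{R}$. *)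

(* Defs.v *)
From HB Require Import structures.
From mathcomp Require Import all_boot all_order all_algebra.
From mathcomp Require Import all_classical all_reals all_analysis.

Set Implicit Arguments.
Unset Strict Implicit.
Unset Printing Implicit Defensive.

Import Order.TTheory GRing.Theory Num.Theory.
Import numFieldNormedType.Exports.

Local Open Scope classical_set_scope.
Local Open Scope ring_scope.

Definition dotprod (R : realType) (p : nat) (x y : 'rV[R]_p) : R :=
  \sum_(i < p) x ord0 i * y ord0 i.

(* The library norm on 'rV[R]_p is the max norm, hence this definition; both
   norms induce the topology used for compactness below. *)
Definition enorm (R : realType) (p : nat) (x : 'rV[R]_p) : R :=
  Num.sqrt (dotprod x x).

Definition usphere (R : realType) (p : nat) : set 'rV[R]_p :=
  [set u | enorm u = 1].

Record Kc (R : realType) (p : nat) := MkKc {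
  Kc_set :> set 'rV[R]_p ;
  Kc_nonempty : Kc_set !=set0 ;
  Kc_compact : compact Kc_set ;
  Kc_convex : convex_set Kc_set }.

(* Defined for every direction u, not only for unit vectors. *)
Definition supp (R : realType) (p : nat) (K : Kc R p) (u : 'rV[R]_p) : R :=
  sup [set dotprod k u | k in (K : set _)].

Record randomSet d (T : measurableType d) (R : realType) (p : nat) :=
  MkRandomSet {
    randomSet_fun :> T -> Kc R p ;
    randomSet_hit : forall K : Kc R p,
      measurable [set w | (randomSet_fun w : set _) `&` K !=set0] }.

Definition Sminus (R : realType) (p : nat) (u : 'rV[R]_p) (t : R) :
  set (Kc R p) := [set K | supp K u <= t].

Definition Splus (R : realType) (p : nat) (u : 'rV[R]_p) (t : R) :
  set (Kc R p) := [set K | t <= supp K u].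

Definition DCT d (T : measurableType d) (R : realType) (p : nat)
    (P : probability T R) (K : Kc R p) (G : randomSet T R p) : \bar R :=
  Order.min
    (ereal_inf [set P (G @^-1` Sminus ut.1 ut.2) | ut in
      [set ut : 'rV[R]_p * R | usphere ut.1 /\ Sminus ut.1 ut.2 K]])
    (ereal_inf [set P (G @^-1` Splus ut.1 ut.2) | ut in
      [set ut : 'rV[R]_p * R | usphere ut.1 /\ Splus ut.1 ut.2 K]]).

Definition closed_halfline (R : realType) (H : set R) : Prop :=
  exists a : R, H = `]-oo, a]%classic \/ H = `[a, +oo[%classic.

Definition HD (R : realType) (x : R) (Q : probability R R) : \bar R :=
  ereal_inf [set Q H | H in [set H | closed_halfline H /\ H x]].

Definition supp_rv d (T : measurableType d) (R : realType) (p : nat)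
  (G : randomSet T R p) (u : 'rV[R]_p) : T -> R := fun w => supp (G w) u.

Section supp_rv_measurable.
Context d (T : measurableType d) (R : realType) (p : nat).
Implicit Types (K : Kc R p) (G : randomSet T R p) (u : 'rV[R]_p).

Lemma continuous_dotprod u : continuous (fun x : 'rV[R]_p => dotprod x u).
Proof.
apply: continuous_big => [|i _ x]; first exact: add_continuous.
apply: (@continuousM R 'rV[R]_p (fun y => y ord0 i) (fun=> u ord0 i)).
  exact: coord_continuous.
by move: x; exact: cst_continuous.
Qed.

Lemma dotprodDl (x y u : 'rV[R]_p) :
  dotprod (x + y) u = dotprod x u + dotprod y u.
Proof.
by rewrite /dotprod -big_split; apply: eq_bigr => i _; rewrite mxE mulrDl.
Qed.

Lemma dotprodZl a (x u : 'rV[R]_p) : dotprod (a *: x) u = a * dotprod x u.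
Proof.
by rewrite /dotprod mulr_sumr; apply: eq_bigr => i _; rewrite mxE mulrA.
Qed.

Lemma le_suppP K u t :
  t <= supp K u <-> exists2 k, (K : set _) k & t <= dotprod k u.
Proof.
have K0 := Kc_nonempty K.
have c : {within (K : set _), continuous (fun x : 'rV[R]_p => dotprod x u)}.
  exact/continuous_subspaceT/continuous_dotprod.
have S : has_sup [set dotprod k u | k in (K : set _)].
  apply: compact_has_sup; first exact: image_nonempty.
  exact/continuous_compact/Kc_compact.
split=> [tK|[k Kk tk]].
  have [k Kk kmax] := EVT_max_rV K0 (Kc_compact (k:=K)) c.
  exists k; first by rewrite inE in Kk.
  apply: le_trans tK _; apply: ge_sup; first exact: image_nonempty.
  by move=> _ [y Ky <-]; apply: kmax; rewrite inE.
by apply: le_trans tk _; apply: sup_upper_bound => //; exists k.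
Qed.

Let slab u t n : set 'rV[R]_p :=
  [set x : 'rV[R]_p | `|x| <= n%:R] `&` [set x | t <= dotprod x u].

Lemma slab_compact u t n : compact (slab u t n).
Proof.
apply: bounded_closed_compact.
  exists n%:R; split; first exact: num_real.
  by move=> M nM x [/= xn _]; apply: le_trans xn (ltW nM).
apply: closedI.
  apply: (@preimage_closed _ _ (fun x : 'rV[R]_p => `|x|) [set y | y <= n%:R]).
    by move=> x _; exact: norm_continuous.
  exact: closed_le.
apply: (@preimage_closed _ _ (fun x => dotprod x u) [set y | t <= y]).
  by move=> x _; exact: continuous_dotprod.
exact: closed_ge.
Qed.

Lemma slab_convex u t n : convex_set (slab u t n).
Proof.
move=> x y l; rewrite !inE => -[/= xn xt] [/= yn yt].
have l0 : 0 <= l%:num by [].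
have l1 : 0 <= 1 - l%:num by rewrite subr_ge0.
have E (a : R) : a = l%:num * a + (1 - l%:num) * a.
  by rewrite -mulrDl addrC subrK mul1r.
have -> : conv l x y = l%:num *: (x : 'rV[R]_p) + (1 - l%:num) *: (y : 'rV[R]_p).
  by [].
split=> /=.
  apply: (le_trans (ler_normD _ _)).
  by rewrite !normrZ !ger0_norm// [leRHS]E lerD// ler_wpM2l.
by rewrite dotprodDl !dotprodZl [leLHS]E lerD// ler_wpM2l.
Qed.

Lemma measurable_supp_rv G u : measurable_fun setT (supp_rv G u).
Proof.
apply: (measurability (measurable_realfun.RGenCInfty.G (R:=R))).
  exact: measurable_realfun.RGenCInfty.measurableE.
move=> _ [_ [t ->] <-]; rewrite setTI.
rewrite (_ : _ @^-1` _ =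
    \bigcup_n [set w | (G w : set _) `&` slab u t n !=set0]).
  apply: bigcupT_measurable => n.
  have [s0|/set0P s0] := eqVneq (slab u t n) set0.
    rewrite (_ : mkset _ = set0)//.
    by apply/seteqP; split=> // w [x []]; rewrite s0.
  exact: (randomSet_hit G (MkKc s0 (@slab_compact u t n) (@slab_convex u t n))).
apply/seteqP; split=> w /=.
  rewrite in_itv/= andbT => /le_suppP[k Kk tk].
  exists (Num.bound `|k|) => //; exists k; split=> //; split=> //=.
  by apply/ltW/archi_boundP.
by move=> [n _ [k [Kk [_ tk]]]]; rewrite in_itv/= andbT; apply/le_suppP; exists k.
Qed.

HB.instance Definition _ G u := isMeasurableFun.Build _ _ T R (supp_rv G u)
  (measurable_supp_rv G u).

End supp_rv_measurable.

(* Main.v *)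
Require Import Defs.
From mathcomp Require Import all_boot all_order all_algebra.
From mathcomp Require Import all_classical all_reals all_analysis.

(** Both sides are the infimum of one and the same family of probabilities.
The event that [G] lies in the halfspace [Sminus u t], respectively
[Splus u t], is the event that the real random variable [supp_rv G u] lies in
the half-line of points at most [t], respectively at least [t], and [K] lies
in the halfspace exactly when the point [supp K u] lies in that half-line.
Hence [DCT] takes the infimum over [u] and [t] for each of the two
orientations and then the minimum, whereas the right-hand side takes, for
each [u], the infimum over all half-lines of both orientations, and then the
infimum over [u]. *)

Set Implicit Arguments.
Unset Strict Implicit.
Unset Printing Implicit Defensive.

Import Order.TTheory.

Local Open Scope classical_set_scope.
Local Open Scope ring_scope.

Section halfspace_events.
Context d (T : measurableType d) (R : realType) (p : nat).
Implicit Types (P : probability T R) (G : randomSet T R p) (u : 'rV[R]_p).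

Lemma preimage_Sminus G u t : G @^-1` Sminus u t = supp_rv G u @^-1` `]-oo, t].
Proof. by apply/seteqP; split=> w; rewrite /= in_itv. Qed.

Lemma preimage_Splus G u t : G @^-1` Splus u t = supp_rv G u @^-1` `[t, +oo[.
Proof. by apply/seteqP; split=> w; rewrite /= in_itv /= andbT. Qed.

Lemma HD_le_Sminus P G (K : Kc R p) u t : Sminus u t K ->
  (HD (supp K u) (distribution P (supp_rv G u)) <= P (G @^-1` Sminus u t))%E.
Proof.
move=> Kt; apply: ereal_inf_lbound; exists `]-oo, t]%classic.
  by split; [exists t; left | rewrite /= in_itv].
by rewrite preimage_Sminus.
Qed.

Lemma HD_le_Splus P G (K : Kc R p) u t : Splus u t K ->
  (HD (supp K u) (distribution P (supp_rv G u)) <= P (G @^-1` Splus u t))%E.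
Proof.
move=> Kt; apply: ereal_inf_lbound; exists `[t, +oo[%classic.
  by split; [exists t; right | rewrite /= in_itv /= andbT].
by rewrite preimage_Splus.
Qed.

Lemma DCT_le_HD P G (K : Kc R p) u : usphere u ->
  (DCT P K G <= HD (supp K u) (distribution P (supp_rv G u)))%E.
Proof.
move=> u1; apply: le_ereal_inf_tmp => _ [_ [[t [->|->]] Kt] <-].
- rewrite ge_min; apply/orP; left; apply: ereal_inf_lbound.
  exists (u, t); last by rewrite preimage_Sminus.
  by split=> //; move: Kt; rewrite /= in_itv.
- rewrite ge_min; apply/orP; right; apply: ereal_inf_lbound.
  exists (u, t); last by rewrite preimage_Splus.
  by split=> //; move: Kt; rewrite /= in_itv /= andbT.
Qed.

End halfspace_events.

Theorem mainTheorem2 (R : realType) (p : nat) (hp : (1 <= p)%N)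
    (d : measure_display) (T : measurableType d) (P : probability T R)
    (G : randomSet T R p) (K : Kc R p) :
  DCT P K G =
    ereal_inf [set HD (supp K u) (distribution P (supp_rv G u))
              | u in @usphere R p].
Proof.
apply/eqP; rewrite eq_le; apply/andP; split.
  by apply: le_ereal_inf_tmp => _ [u u1 <-]; exact: DCT_le_HD.
rewrite le_min; apply/andP; split;
  apply: le_ereal_inf_tmp => _ [[u t] [u1 Kt] <-].
- apply: le_trans (HD_le_Sminus P G Kt).
  by apply: ereal_inf_lbound; exists u.
- apply: le_trans (HD_le_Splus P G Kt).
  by apply: ereal_inf_lbound; exists u.
Qed.
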